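(* There exists a function $\varepsilon:\mathbb{N}\to\mathbb{R}$ with $\varepsilon(d)\to 0$ as $d\to\infty$ such that the following holds. For every finite triangle-free graph $G$ there exists a probability distribution $\mathcal{D}$ on the independent sets of $G$ such that $$\mathbb{P}_{I\sim \mathcal{D}}[v\in I]\ge (1-\varepsilon(d_G(v)))\frac{\ln(d_G(v))}{d_G(v)}$$ for every vertex $v\in V(G)$ with $d_G(v)\ge 1$.
   Context: $d_G(v)$ denotes the degree of vertex $v$ in $G$. A graph is triangle-free if it contains no three pairwise adjacent vertices. An independent set is a set of pairwise non-adjacent vertices. *)

(* Defs.v *)
From mathcomp Require Import all_boot all_order all_algebra.

Set Implicit Arguments.
Unset Strict Implicit.
Unset Printing Implicit Defensive.

Import Order.TTheory GRing.Theory Num.Theory.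
Local Open Scope ring_scope.

Definition simple_graph (T : finType) (e : rel T) : Prop :=
  symmetric e /\ irreflexive e.

Definition degree (T : finType) (e : rel T) (v : T) : nat :=
  #|[set w | e v w]|.

Definition triangle_free (T : finType) (e : rel T) : Prop :=
  forall x y z : T, ~ [/\ e x y, e y z & e x z].

Definition independent (T : finType) (e : rel T) (I : {set T}) : Prop :=
  {in I &, forall x y, ~~ e x y}.

(* [D] is the probability mass function of the distribution, extended by zero
   to the vertex sets that are not independent. *)
Definition indep_distr (R : numDomainType) (T : finType) (e : rel T)
    (D : {ffun {set T} -> R}) : Prop :=
  [/\ forall I, 0 <= D I,
      \sum_I D I = 1
    & forall I, D I != 0 -> independent e I].

Definition prob_mem (R : numDomainType) (T : finType)
    (D : {ffun {set T} -> R}) (v : T) : R :=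
  \sum_(I : {set T} | v \in I) D I.

(* Main.v *)
Require Import Defs.
From mathcomp Require Import all_boot all_order all_algebra.
From mathcomp Require Import all_classical all_reals all_analysis.
From mathcomp Require Import ring lra.

Set Implicit Arguments.
Unset Strict Implicit.
Unset Printing Implicit Defensive.

Import Order.TTheory GRing.Theory Num.Theory.
Import numFieldNormedType.Exports.
Local Open Scope ring_scope.

(** Grow a random independent set [I] in small time steps, and call a vertex alive if
    neither it nor a neighbour is in [I].  Put [a_u = P(no neighbour of u is in I)] and,
    for adjacent [u], [v], [c_uv = P(u, v alive) / (a_u a_v)]; initially [c] is the
    adjacency matrix.  Selecting an alive [u] at rate [s_u / a_u] gives
    [a_u' = - a_u (c s)_u] and raises [P(u in I)] at rate [s_u P(u alive) / a_u], which is
    about [s_u].  So if [(c s)_u <= (d_u + 1) s_u], then [a_u] stays above about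
    [exp (- d_u P(u in I))], and [u] can go on until [P(u in I)] is about [ln d_u / d_u].

    The rates [s] are chosen adaptively: [s] solves [(L - c) s = 1] with
    [L = diag (d_u + 1)] on the vertices that have not reached their target.  Because the
    graph is triangle-free, Cauchy-Schwarz gives [s^T c' s <= 0], which is exactly the
    statement that [1^T (L - c)^-1 1] does not increase to first order.  This quantity is
    the maximum of [2 * \sum x - x^T (L - c) x]; its boundedness keeps [L - c] uniformly
    positive definite, so [s] exists, is nonnegative and bounded, and one step size works
    throughout. *)

(** * Critical points of quadratic objectives *)

Lemma injective_linear_system_solvable (F : fieldType) (T : finType)
    (m : T -> T -> F) (b : T -> F) :
    (forall x : T -> F, (forall u, \sum_v m u v * x v = 0) -> forall u, x u = 0) ->
  exists x : T -> F, forall u, \sum_v m u v * x v = b u.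
Proof.
move=> inj.
pose M := \matrix_(i, j < #|T|) m (enum_val j) (enum_val i).
have mulE (x : 'rV[F]_#|T|) j :
    (x *m M) 0 j = \sum_v m (enum_val j) v * x 0 (enum_rank v).
  rewrite mxE (reindex_onto enum_rank enum_val) /=; last by move=> i _; rewrite enum_valK.
  by apply: eq_big => v; rewrite ?enum_rankK ?eqxx // => _; rewrite mxE enum_rankK mulrC.
have freeM : row_free M.
  rewrite -kermx_eq0; apply/rowV0P => x /sub_kermxP xM0.
  apply/rowP => i; rewrite mxE -(enum_valK i).
  apply: (inj (fun v => x 0 (enum_rank v))) => u.
  by have := mulE x (enum_rank u); rewrite xM0 mxE enum_rankK => <-.
have unitM : M \in unitmx by rewrite -row_free_unit.
pose x := (\row_j b (enum_val j)) *m invmx M.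
exists (fun v => x 0 (enum_rank v)) => u.
have := mulE x (enum_rank u).
by rewrite /x mulmxKV // mxE enum_rankK => <-.
Qed.

Section QuadraticObjective.
Variables (R : realFieldType) (T : finType).
Implicit Types (B : {set T}) (l x s : T -> R) (c : T -> T -> R).

Definition bilin B c x y : R := \sum_(u in B) \sum_(v in B) c u v * x u * y v.

Definition qform B l c x : R := \sum_(u in B) l u * x u ^+ 2 - bilin B c x x.

Definition objective B l c x : R := 2 * \sum_(u in B) x u - qform B l c x.

Lemma bilinDl B c x1 x2 y :
  bilin B c (fun u => x1 u + x2 u) y = bilin B c x1 y + bilin B c x2 y.
Proof.
rewrite /bilin -big_split; apply: eq_bigr => u _; rewrite -big_split /=.
by apply: eq_bigr => v _; ring.
Qed.

Lemma bilinC B c x y : (forall u v, c u v = c v u) -> bilin B c x y = bilin B c y x.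
Proof.
move=> csym; rewrite /bilin exchange_big; apply: eq_bigr => u _ /=.
by apply: eq_bigr => v _; rewrite csym; ring.
Qed.

Lemma bilin_sqrD B c x s z :
    (forall u v, c u v = c v u) -> (forall u, x u = s u + z u) ->
  bilin B c x x = bilin B c s s + 2 * bilin B c s z + bilin B c z z.
Proof.
move=> csym xE; transitivity (bilin B c (fun u => s u + z u) (fun u => s u + z u)).
  by apply: eq_bigr => u _; apply: eq_bigr => v _; rewrite !xE.
rewrite bilinDl (bilinC B s _ csym) (bilinC B z _ csym) !bilinDl (bilinC B z s csym); ring.
Qed.

Lemma bilin_norm B c x y (w : R) :
    (forall u v, u \in B -> v \in B -> `|c u v| <= w) ->
  `|bilin B c x y| <= w * (\sum_(u in B) `|x u|) * \sum_(u in B) `|y u|.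
Proof.
move=> cw; apply: le_trans (ler_norm_sum _ _ _) _.
rewrite -mulrA mulr_suml mulr_sumr; apply: ler_sum => u uB.
apply: le_trans (ler_norm_sum _ _ _) _.
rewrite mulrA mulr_sumr; apply: ler_sum => v vB.
rewrite !normrM ler_wpM2r // ler_wpM2r //; exact: cw.
Qed.

(** Passing to absolute values keeps the squares, cannot lower the linear term and, as [c] is
    nonnegative, cannot lower the cross terms. *)
Lemma objective_norm B l c x :
    (forall u v, u \in B -> v \in B -> 0 <= c u v) ->
  objective B l c x <= objective B l c (fun u => `|x u|).
Proof.
move=> c0; rewrite /objective /qform /bilin.
have -> : \sum_(u in B) l u * `|x u| ^+ 2 = \sum_(u in B) l u * x u ^+ 2.
  by apply: eq_bigr => u _; rewrite real_normK // num_real.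
have h1 : \sum_(u in B) x u <= \sum_(u in B) `|x u|.
  by apply: ler_sum => u _; exact: ler_norm.
suff : \sum_(u in B) \sum_(v in B) c u v * x u * x v <=
  \sum_(u in B) \sum_(v in B) c u v * `|x u| * `|x v| by lra.
apply: ler_sum => u uB; apply: ler_sum => v vB.
rewrite -!mulrA ler_wpM2l ?c0 // -normrM; exact: ler_norm.
Qed.

Lemma qform_norm B l c x :
    (forall u v, u \in B -> v \in B -> 0 <= c u v) ->
  qform B l c (fun u => `|x u|) <= qform B l c x.
Proof.
move=> c0; rewrite /qform /bilin.
have -> : \sum_(u in B) l u * `|x u| ^+ 2 = \sum_(u in B) l u * x u ^+ 2.
  by apply: eq_bigr => u _; rewrite real_normK // num_real.
rewrite lerD2l lerN2.
apply: ler_sum => u uB; apply: ler_sum => v vB.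
rewrite -!mulrA ler_wpM2l ?c0 // -normrM; exact: ler_norm.
Qed.

Lemma qformZ B l c x (k : R) : qform B l c (fun u => k * x u) = k ^+ 2 * qform B l c x.
Proof.
rewrite /qform /bilin mulrBr !mulr_sumr; congr (_ - _).
  by apply: eq_bigr => u _; ring.
apply: eq_bigr => u _; rewrite !mulr_sumr; apply: eq_bigr => v _; ring.
Qed.

(* Optimising the hypothesis over the multiples of [|x|] gives the bound. *)
Lemma objective_bound_coercive B l c (J : R) x :
    0 < J -> (forall u v, u \in B -> v \in B -> 0 <= c u v) ->
    (forall y, objective B l c y <= J) ->
  (\sum_(u in B) `|x u|) ^+ 2 <= J * qform B l c x.
Proof.
move=> J0 c0 objJ; set X := \sum_(u in B) `|x u|.
apply: le_trans (_ : J * qform B l c (fun u => `|x u|) <= _); last first.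
  by apply: ler_wpM2l; [exact: ltW | exact: qform_norm].
set Q := qform _ _ _ _.
have key k : 2 * (k * X) - k ^+ 2 * Q <= J.
  by have := objJ (fun u => k * `|x u|); rewrite /objective qformZ -mulr_sumr.
have [X0|X0] := eqVneq X 0.
  rewrite X0 expr0n /= mulr_ge0 ?(ltW J0) //.
  rewrite leNgt; apply/negP => Q0.
  (* If [Q] were negative, this multiplier [k >= 1] would give [- k ^+ 2 * Q >= k * - Q > J]. *)
  have := key ((1 + J) / - Q + 1); rewrite X0 mulr0 mulr0 sub0r => h.
  have nQ : 0 < - Q by rewrite oppr_gt0.
  have : (1 + J) / - Q * - Q = 1 + J by rewrite mulfVK // gt_eqF.
  have : 0 <= (1 + J) / - Q by rewrite divr_ge0 //; lra.
  move: ((1 + J) / - Q) h => z; nra.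
(* [J / X] is the optimal multiplier when the claim is an equality; unlike [X / Q] it needs no
   knowledge of the sign of [Q]. *)
have := key (J / X).
have -> : 2 * (J / X * X) - (J / X) ^+ 2 * Q = 2 * J - J ^+ 2 * Q / X ^+ 2 by field.
move=> h; have X20 : 0 < X ^+ 2 by rewrite exprn_even_gt0.
have {h} : J <= J ^+ 2 * Q / X ^+ 2 by lra.
rewrite ler_pdivlMr //.
have -> : J ^+ 2 * Q = J * (J * Q) by ring.
by rewrite ler_pM2l.
Qed.

(** Completing the square: at a solution [s] of [(L - c) s = 1] the part linear in [x - s]
    cancels. *)
Lemma qformB_objective B l c s x :
    (forall u v, c u v = c v u) ->
    (forall u, u \in B -> l u * s u = 1 + \sum_(v in B) c u v * s v) ->
  objective B l c x = \sum_(u in B) s u - qform B l c (fun u => x u - s u).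
Proof.
move=> csym eqs.
have lin y : \sum_(u in B) y u = \sum_(u in B) l u * s u * y u - bilin B c s y.
  rewrite bilinC // /bilin -sumrB; apply: eq_bigr => u uB; rewrite eqs //.
  rewrite mulrDl mul1r mulr_suml -addrA -sumrB big1 ?addr0 // => v _; ring.
rewrite /objective (lin x) {1}(lin s) /qform.
have -> : bilin B c x x = bilin B c s s + 2 * bilin B c s (fun u => x u - s u)
    + bilin B c (fun u => x u - s u) (fun u => x u - s u).
  by apply: bilin_sqrD => // u; ring.
have -> : bilin B c s x = bilin B c s s + bilin B c s (fun u => x u - s u).
  rewrite /bilin -big_split; apply: eq_bigr => u _; rewrite -big_split.
  by apply: eq_bigr => v _ /=; ring.
have -> : \sum_(u in B) l u * (x u - s u) ^+ 2 =
  \sum_(u in B) l u * x u ^+ 2 - (\sum_(u in B) l u * s u * x u) * 2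
    + \sum_(u in B) l u * s u * s u.
  by rewrite mulr_suml -sumrB -big_split; apply: eq_bigr => u _ /=; ring.
by ring.
Qed.

(** By [objective_bound_coercive] the form is positive definite on [B], so the system is solvable
    there. The solution is the unique maximiser, with value [\sum s]; passing to [|s|] does not
    lower the objective, so [s = |s|]. *)
Lemma objective_critical_point B l c (J : R) :
    0 < J -> (forall u v, c u v = c v u) ->
    (forall u v, u \in B -> v \in B -> 0 <= c u v) ->
    (forall x, objective B l c x <= J) ->
  exists s : T -> R,
    [/\ forall u, u \in B -> l u * s u = 1 + \sum_(v in B) c u v * s v,
        forall u, u \in B -> 0 <= s u & \sum_(u in B) s u <= J].
Proof.
move=> J0 csym c0 objJ.
have zero y : qform B l c y <= 0 -> forall u, u \in B -> y u = 0.
  move=> Q0 u uB; have := objective_bound_coercive y J0 c0 objJ => le.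
  have S0 : 0 <= \sum_(v in B) `|y v| by apply: sumr_ge0.
  have : \sum_(v in B) `|y v| = 0 by nra.
  move/psumr_eq0P => /(_ (fun _ _ => normr_ge0 _)) /(_ u uB) /eqP.
  by rewrite normr_eq0 => /eqP.
(* The identity outside [B] makes the system square over all of [T]. *)
pose m u v : R := if u \in B then (if v \in B then l u * (u == v)%:R - c u v else 0)
                 else (u == v)%:R.
have sumE x u : u \in B ->
    \sum_v m u v * x v = l u * x u - \sum_(v in B) c u v * x v.
  move=> uB; rewrite [LHS](bigID [in B]) /= [X in _ + X]big1 ?addr0; last first.
    by move=> v /negPf vB; rewrite /m uB vB mul0r.
  have -> : l u * x u = \sum_(v in B) l u * (u == v)%:R * x v.
    rewrite (bigD1 u) //= eqxx mulr1 big1 ?addr0 // => v /andP[_ /negPf].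
    by rewrite eq_sym => ->; rewrite mulr0 mul0r.
  by rewrite -sumrB; apply: eq_bigr => v vB; rewrite /m uB vB mulrBl.
have sumN x u : u \notin B -> \sum_v m u v * x v = x u.
  move=> /negPf uB; rewrite (bigD1 u) //= /m uB eqxx mul1r big1 ?addr0 // => v /negPf.
  by rewrite eq_sym => ->; rewrite mul0r.
have [|s eqs] := @injective_linear_system_solvable R T m (fun u => (u \in B)%:R).
  move=> x eqx u; case: (boolP (u \in B)) => [uB|uB]; last by rewrite -(sumN x).
  apply: zero uB; rewrite /qform /bilin -sumrB big1 // => v vB.
  have := eqx v; rewrite sumE // => h.
  have -> : l v * x v ^+ 2 = x v * (l v * x v) by ring.
  have -> : \sum_(w in B) c v w * x v * x w = x v * \sum_(w in B) c v w * x w.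
    by rewrite mulr_sumr; apply: eq_bigr => w _; ring.
  by rewrite -mulrBr h mulr0.
have {}eqs u : u \in B -> l u * s u = 1 + \sum_(v in B) c u v * s v.
  by move=> uB; have := eqs u; rewrite sumE // uB => /eqP; rewrite subr_eq => /eqP.
have objs : objective B l c s = \sum_(u in B) s u.
  have q0 : qform B l c (fun u => s u - s u) = 0.
    rewrite /qform /bilin !big1 ?subrr // => u _; last by rewrite subrr expr0n mulr0.
    by apply: big1 => v _; rewrite subrr mulr0 mul0r.
  by rewrite (qformB_objective _ csym eqs) q0 subr0.
exists s; split=> // [u uB|]; last by rewrite -objs.
have : `|s u| - s u = 0.
  apply: (zero (fun u => `|s u| - s u)) uB.
  have := objective_norm l s c0; rewrite objs (qformB_objective _ csym eqs); lra.
by move/eqP; rewrite subr_eq0 => /eqP <-.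
Qed.

(* With [z = x - s], the first-order change at [s] is nonpositive and the coercive
   term [- (\sum |z|)^2 / J] absorbs the cross terms. *)
Lemma objective_perturbation B B' l c c' (W : T -> T -> R) s (J d w K k : R) :
    B' \subset B -> 1 <= J -> (forall u v, c u v = c v u) ->
    (forall u v, u \in B -> v \in B -> 0 <= c u v) ->
    (forall u v, u \in B -> v \in B -> 0 <= c' u v) ->
    (forall u v, W u v = W v u) ->
    (forall x, objective B l c x <= J) ->
    (forall u, u \in B -> l u * s u = 1 + \sum_(v in B) c u v * s v) ->
    (forall u, u \in B -> 0 <= s u) -> \sum_(u in B) s u <= J ->
    (forall u v, u \in B -> v \in B -> c' u v <= c u v + d * W u v + d ^+ 2 * K) ->
    (forall u v, u \in B -> v \in B -> `|W u v| <= w) ->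
    bilin B W s s <= 0 ->
    0 <= d -> d <= 1 -> 0 <= w -> 0 <= K -> 4 * J * w * d <= 1 -> 8 * J * K * d <= 1 ->
    d * (2 * J ^+ 3 * w ^+ 2 + 2 * K * J ^+ 2) <= k ->
  forall x, objective B' l c' x <= \sum_(u in B) s u + d * k.
Proof.
move=> B'B J1 csym c0 c'0 Wsym objJ eqs s0 sJ c'le Ww Wss d0 d1 w0 K0 wd Kd dk x0.
have sub0 (F : T -> R) : (forall u, u \notin B' -> F u = 0) ->
    \sum_(u in B') F u = \sum_(u in B) F u.
  move=> F0; rewrite [RHS](bigID [in B']) /= [X in _ + X]big1 ?addr0; last first.
    by move=> u /andP[_]; exact: F0.
  apply: eq_bigl => u; case: (boolP (u \in B')) => [|_]; last by rewrite andbF.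
  by move=> /(fintype.subsetP B'B) ->.
apply: le_trans (objective_norm _ _ _) _.
  by move=> u v /(fintype.subsetP B'B) uB /(fintype.subsetP B'B) vB; exact: c'0.
(* Extension by zero turns a vector on [B'] into a competitor on [B]; nonnegativity lets the
   entrywise bounds on [c'] pass to the forms. *)
pose x u : R := if u \in B' then `|x0 u| else 0.
have x_ge0 u : 0 <= x u by rewrite /x; case: ifP.
have -> : objective B' l c' (fun u => `|x0 u|) = objective B l c' x.
  rewrite /objective /qform /bilin.
  rewrite -(sub0 x); last by move=> u /negPf uB; rewrite /x uB.
  rewrite -(sub0 (fun u => l u * x u ^+ 2)); last first.
    by move=> u /negPf uB; rewrite /x uB expr0n mulr0.
  rewrite -(sub0 (fun u => \sum_(v in B) c' u v * x u * x v)); last first.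
    by move=> u /negPf uB; rewrite big1 // => v _; rewrite /x uB mulr0 mul0r.
  congr (2 * _ - (_ - _)).
  - by apply: eq_bigr => u uB; rewrite /x uB.
  - by apply: eq_bigr => u uB; rewrite /x uB.
  apply: eq_bigr => u uB.
  rewrite -(sub0 (fun v => c' u v * x u * x v)); last first.
    by move=> v /negPf vB; rewrite /x vB mulr0.
  by apply: eq_bigr => v vB; rewrite /x uB vB.
pose z u := x u - s u.
set Z := \sum_(u in B) `|z u|; set X := \sum_(u in B) x u; set S := \sum_(u in B) s u.
have Z0 : 0 <= Z by apply: sumr_ge0.
have S0 : 0 <= S by apply: sumr_ge0.
have SJ : S <= J by [].
have X0 : 0 <= X by apply: sumr_ge0.
have XSZ : X <= S + Z.
  by rewrite /X /S /Z -big_split; apply: ler_sum => u _ /=; have := ler_norm (z u);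
    rewrite /z; lra.
have ler1 : objective B l c' x <= objective B l c x + d * bilin B W x x + d ^+ 2 * K * X ^+ 2.
  rewrite /objective /qform.
  suff : bilin B c' x x <= bilin B c x x + d * bilin B W x x + d ^+ 2 * K * X ^+ 2 by lra.
  have -> : d ^+ 2 * K * X ^+ 2 = \sum_(u in B) \sum_(v in B) d ^+ 2 * K * x u * x v.
    rewrite (expr2 X) {1}/X mulr_suml mulr_sumr; apply: eq_bigr => u _.
    by rewrite mulrA mulr_sumr.
  rewrite /bilin mulr_sumr -!big_split; apply: ler_sum => u uB /=.
  rewrite mulr_sumr -!big_split; apply: ler_sum => v vB /=.
  have := c'le u v uB vB; have := mulr_ge0 (x_ge0 u) (x_ge0 v).
  move: (x u * x v) (mulrA (c' u v) (x u) (x v)) (mulrA (c u v) (x u) (x v))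
    (mulrA (W u v) (x u) (x v)) (mulrA (d ^+ 2 * K) (x u) (x v)).
  move=> xx <- <- <- <- xx0 h.
  have -> : c u v * xx + d * (W u v * xx) + d ^+ 2 * K * xx =
    (c u v + d * W u v + d ^+ 2 * K) * xx by ring.
  exact: ler_wpM2r.
apply: le_trans ler1 _.
rewrite (qformB_objective _ csym eqs) -/S.
have J0 : 0 < J by lra.
have coer := objective_bound_coercive z J0 c0 objJ; rewrite -/Z -/z in coer.
set Q := qform B l c _.
have {}coer : Z ^+ 2 <= J * Q by [].
have Wxx : bilin B W x x <= w * (2 * J * Z + Z ^+ 2).
  have -> : bilin B W x x = bilin B W s s + 2 * bilin B W s z + bilin B W z z.
    by apply: bilin_sqrD => // u; rewrite /z; ring.
  have := bilin_norm s z Ww; rewrite -/Z.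
  have -> : \sum_(u in B) `|s u| = S by apply: eq_bigr => u uB; rewrite ger0_norm ?s0.
  move/(le_trans (ler_norm _)) => h1.
  have := le_trans (ler_norm _) (bilin_norm z z Ww); rewrite -/Z => h2.
  have : w * S * Z <= w * J * Z by rewrite ler_wpM2r // ler_wpM2l.
  lra.
have dw : d * bilin B W x x <= d * (w * (2 * J * Z + Z ^+ 2)) by rewrite ler_wpM2l.
have XJZ : X ^+ 2 <= 2 * (J ^+ 2 + Z ^+ 2).
  have : X ^+ 2 <= (J + Z) ^+ 2 by rewrite ler_sqr ?nnegrE; lra.
  have := sqr_ge0 (J - Z); lra.
have KX : d ^+ 2 * K * X ^+ 2 <= d ^+ 2 * K * (2 * (J ^+ 2 + Z ^+ 2)).
  by rewrite ler_wpM2l // mulr_ge0 // sqr_ge0.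
suff : d * (w * (2 * J * Z + Z ^+ 2)) + d ^+ 2 * K * (2 * (J ^+ 2 + Z ^+ 2)) <= Q + d * k.
  by lra.
(* By coercivity [V] is at most [Q]. The estimates [e1], [e2], [e3] spend [V / 4], [V / 4] and
   [V / 2] of it; the rest is of order [d ^+ 2] and fits into [d * k]. *)
pose V := Z ^+ 2 / J.
have Z2 : Z ^+ 2 = J * V by rewrite /V; field; rewrite gt_eqF.
have V0 : 0 <= V by rewrite divr_ge0 ?sqr_ge0 ?(ltW J0).
have VQ : V <= Q by rewrite /V ler_pdivrMr // mulrC.
have e1 : d * w * Z ^+ 2 <= V / 4.
  have : (4 * J * w * d) * V <= 1 * V by rewrite ler_wpM2r.
  rewrite Z2; lra.
have e2 : d ^+ 2 * K * (2 * Z ^+ 2) <= V / 4.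
  have Kd0 : 0 <= 8 * J * K * d by rewrite !mulr_ge0 // (ltW J0).
  have : (8 * J * K * d) * d <= 1 by rewrite mulr_ile1.
  move/(ler_wpM2r V0); rewrite Z2; lra.
have e3 : 2 * J * d * w * Z <= V / 2 + 2 * J ^+ 3 * d ^+ 2 * w ^+ 2.
  have := sqr_ge0 (Z - 2 * J ^+ 2 * d * w) => h.
  have : 0 <= (Z - 2 * J ^+ 2 * d * w) ^+ 2 / (2 * J) by rewrite divr_ge0 //; lra.
  have -> : (Z - 2 * J ^+ 2 * d * w) ^+ 2 / (2 * J) =
    V / 2 + 2 * J ^+ 3 * d ^+ 2 * w ^+ 2 - 2 * J * d * w * Z.
    by rewrite /V; field; rewrite gt_eqF.
  by lra.
have e4 := ler_wpM2l d0 dk.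
by lra.
Qed.
End QuadraticObjective.

(** * One greedy selection step *)

Section GreedyStep.
Variables (R : realFieldType) (T : finType) (e : rel T).
Hypotheses (e_sym : symmetric e) (e_irr : irreflexive e) (e_tri : triangle_free e).
Implicit Types (D : {ffun {set T} -> R}) (F G : {set T} -> R) (rho : T -> R).
Implicit Types (I J : {set T}) (u v x : T).

Definition expect D F : R := \sum_I D I * F I.

Definition unblocked u I : bool := [forall v in I, ~~ e u v].

Definition alive u I : bool := (u \notin I) && unblocked u I.

Definition punblocked D u : R := expect D (fun I => (unblocked u I)%:R).

Definition palive D u : R := expect D (fun I => (alive u I)%:R).

Definition palive2 D u v : R := expect D (fun I => (alive u I)%:R * (alive v I)%:R).

(** Draw a set from [D] and at most one vertex, [u] with probability [rho u], and add the vertex if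
    it is alive. The first term is the mass that stays at [J], the second the mass that moves
    there. *)
Definition greedy_step D rho : {ffun {set T} -> R} :=
  [ffun J => D J * (1 - \sum_u rho u * (alive u J)%:R)
     + \sum_u \sum_(I | u |: I == J) rho u * D I * (alive u I)%:R].

Lemma eq_expect D F G : (forall I, F I = G I) -> expect D F = expect D G.
Proof. by move=> FG; apply: eq_bigr => I _; rewrite FG. Qed.

Lemma le_expect D F G :
  (forall I, 0 <= D I) -> (forall I, F I <= G I) -> expect D F <= expect D G.
Proof. by move=> D0 FG; apply: ler_sum => I _; rewrite ler_wpM2l. Qed.

Lemma expect_ge0 D F : (forall I, 0 <= D I) -> (forall I, 0 <= F I) -> 0 <= expect D F.
Proof. by move=> D0 F0; apply: sumr_ge0 => I _; rewrite mulr_ge0. Qed.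

Lemma expectD D F G : expect D (fun I => F I + G I) = expect D F + expect D G.
Proof. by rewrite /expect -big_split; apply: eq_bigr => I _; rewrite mulrDr. Qed.

Lemma expectZ D (k : R) F : expect D (fun I => k * F I) = k * expect D F.
Proof. by rewrite /expect mulr_sumr; apply: eq_bigr => I _; ring. Qed.

Lemma expect_sum D (P : pred T) (F : T -> {set T} -> R) :
  expect D (fun I => \sum_(u | P u) F u I) = \sum_(u | P u) expect D (F u).
Proof.
rewrite /expect exchange_big; apply: eq_bigr => I _ /=.
by rewrite mulr_sumr.
Qed.

(** The generator of the step: the update rules below are instances in which [F] is an indicator, a
    product of two, or [1]. *)
Lemma expect_greedy_step D rho F :
  expect (greedy_step D rho) F =
  expect D F + \sum_u rho u * expect D (fun I => (alive u I)%:R * (F (u |: I) - F I)).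
Proof.
rewrite /expect.
under eq_bigr do rewrite ffunE mulrDl mulr_suml.
rewrite big_split /= [X in _ + X]exchange_big /=.
have -> : \sum_u \sum_J (\sum_(I | u |: I == J) rho u * D I * (alive u I)%:R) * F J =
    \sum_u \sum_I rho u * D I * (alive u I)%:R * F (u |: I).
  apply: eq_bigr => u _; under eq_bigr do rewrite mulr_suml.
  rewrite (exchange_big_dep predT) //=; apply: eq_bigr => I _.
  by rewrite (big_pred1 (u |: I)) // => J; rewrite eq_sym.
have -> : \sum_I D I * (1 - \sum_u rho u * (alive u I)%:R) * F I =
    \sum_I D I * F I - \sum_u \sum_I rho u * D I * (alive u I)%:R * F I.
  rewrite exchange_big -sumrB; apply: eq_bigr => I _ /=.
  rewrite mulrBr mulr1 mulrBl; congr (_ - _).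
  by rewrite mulr_sumr mulr_suml; apply: eq_bigr => u _; ring.
rewrite -addrA; congr (_ + _); rewrite addrC -sumrB; apply: eq_bigr => u _.
by rewrite -sumrB mulr_sumr; apply: eq_bigr => I _; ring.
Qed.

Lemma prob_memE D v : prob_mem D v = expect D (fun I => (v \in I)%:R).
Proof.
rewrite /prob_mem /expect big_mkcond; apply: eq_bigr => I _.
by case: (v \in I); rewrite ?mulr1 ?mulr0.
Qed.

Lemma unblockedU1 u x I : unblocked u (x |: I) = ~~ e u x && unblocked u I.
Proof.
apply/forall_inP/andP => [h|[ux /forall_inP h] v]; last first.
  by rewrite finset.in_setU1 => /orP[/eqP -> //|]; exact: h.
split; first by apply: h; rewrite finset.setU11.
by apply/forall_inP => v vI; apply: h; rewrite finset.in_setU1 vI orbT.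
Qed.

Lemma aliveU1 u x I : alive u (x |: I) = [&& u != x, ~~ e u x & alive u I].
Proof.
rewrite /alive unblockedU1 finset.in_setU1 negb_or -!andbA; congr (_ && _).
by rewrite andbCA.
Qed.

Lemma greedy_step_distr D rho :
    indep_distr e D -> (forall u, 0 <= rho u) -> \sum_u rho u <= 1 ->
  indep_distr e (greedy_step D rho).
Proof.
move=> [D0 D1 DI] rho0 rho1; split.
- move=> J; rewrite ffunE addr_ge0 //.
    rewrite mulr_ge0 // subr_ge0; apply: le_trans rho1.
    apply: ler_sum => u _; case: (alive u J); rewrite ?mulr1 ?mulr0 //.
  by apply: sumr_ge0 => u _; apply: sumr_ge0 => I _; rewrite !mulr_ge0.
- transitivity (expect (greedy_step D rho) (fun=> 1)).
    by apply: eq_bigr => I _; rewrite mulr1.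
  rewrite expect_greedy_step [X in _ + X]big1 ?addr0.
    by rewrite -[RHS]D1; apply: eq_bigr => I _; rewrite mulr1.
  move=> u _; rewrite /expect big1 ?mulr0 // => I _; rewrite subrr !mulr0 //.
move=> J; rewrite ffunE; have [DJ0|DJ _] := eqVneq (D J) 0; last exact: DI.
(* A set without mass can gain some only from an independent set extended by an alive vertex;
   failing that, every summand vanishes. *)
rewrite DJ0 mul0r add0r; have [/existsP[[u I]] /= |/existsPn noI] :=
    boolP [exists p : T * {set T}, [&& p.1 |: p.2 == J, D p.2 != 0 & alive p.1 p.2]].
  move=> /and3P[/eqP <- /DI indI /andP[uI /forall_inP uf]] _ x y.
  rewrite !finset.in_setU1 => /orP[/eqP ->|xI] /orP[/eqP ->|yI].
  - by rewrite e_irr.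
  - exact: uf.
  - by rewrite e_sym uf.
  - exact: indI.
rewrite big1 ?eqxx // => u _; rewrite big1 // => I uIJ.
have := noI (u, I); rewrite /= uIJ /= negb_and negbK => /orP[/eqP ->|/negPf ->].
  by rewrite mulr0 mul0r.
by rewrite mulr0.
Qed.

Lemma prob_mem_greedy_step D rho v :
  prob_mem (greedy_step D rho) v = prob_mem D v + rho v * palive D v.
Proof.
rewrite !prob_memE expect_greedy_step; congr (_ + _).
rewrite (bigD1 v) //= [X in _ + X]big1 ?addr0.
  congr (_ * _); apply: eq_expect => I; rewrite finset.setU11 /alive.
  by case: (v \in I); rewrite ?mul0r //= subr0 mulr1.
move=> u uv; rewrite /expect big1 ?mulr0 // => I _.
by rewrite finset.in_setU1 eq_sym (negPf uv) subrr !mulr0.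
Qed.

(** An alive neighbour already keeps [u] out of the set. Hence selecting [x] costs [punblocked] at
    [u] exactly the event that both are alive. *)
Lemma alive_unblocked u x I : e u x -> alive x I -> unblocked u I -> alive u I.
Proof.
move=> ux /andP[_ /forall_inP xf] uI; rewrite /alive uI andbT.
by apply/negP => /xf; rewrite e_sym ux.
Qed.

Lemma punblocked_greedy_step D rho u :
  punblocked (greedy_step D rho) u =
  punblocked D u - \sum_(x | e u x) rho x * palive2 D u x.
Proof.
rewrite /punblocked expect_greedy_step; congr (_ + _).
rewrite -sumrN [RHS]big_mkcond; apply: eq_bigr => x _; case: ifP => ux.
  rewrite -mulrN; congr (_ * _); rewrite /palive2 -mulN1r -expectZ.
  apply: eq_expect => I; rewrite unblockedU1 ux /= sub0r.
  case Ax: (alive x I); rewrite ?mul0r ?mulr0 ?mul1r ?mulr1 //.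
  have -> : alive u I = unblocked u I by apply/idP/idP => [/andP[]|/(alive_unblocked ux Ax)].
  by rewrite mulN1r.
by rewrite /expect big1 ?mulr0 // => I _; rewrite unblockedU1 ux subrr !mulr0.
Qed.

Definition neighbor_alive (s : T -> R) u I : R := \sum_(x | e u x) s x * (alive x I)%:R.

(* Triangle-freeness enters here: a selected vertex kills the pair through exactly
   one of its two ends. *)
Lemma palive2_greedy_step D rho u v : e u v ->
  palive2 (greedy_step D rho) u v =
  palive2 D u v - expect D (fun I => (alive u I)%:R * (alive v I)%:R
     * (neighbor_alive rho u I + neighbor_alive rho v I)).
Proof.
move=> uv; rewrite /palive2 expect_greedy_step; congr (_ + _).
have -> : expect D (fun I => (alive u I)%:R * (alive v I)%:R
     * (neighbor_alive rho u I + neighbor_alive rho v I)) =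
   \sum_x rho x * expect D (fun I => (alive u I)%:R * (alive v I)%:R
     * (((e u x)%:R + (e v x)%:R) * (alive x I)%:R)).
  under eq_bigr do rewrite -expectZ.
  rewrite -expect_sum; apply: eq_expect => I.
  rewrite /neighbor_alive !(big_mkcond (e _)) -big_split mulr_sumr /=.
  apply: eq_bigr => x _; case: (e u x); case: (e v x); rewrite /=; ring.
rewrite -sumrN; apply: eq_bigr => x _; rewrite -mulrN; congr (_ * _).
rewrite -[RHS]mulN1r -expectZ.
apply: eq_expect => I; rewrite !aliveU1.
have excl : ~~ (e u x && e v x).
  by apply/negP => /andP[ux vx]; apply: (e_tri (x := u) (y := v) (z := x)).
(* Selecting an end kills the pair too; it is counted once, as a neighbour of the other end. *)
have [ux|ux] := eqVneq u x.
  by subst x; rewrite e_irr (e_sym v u) uv /=; ring.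
have [vx|vx] := eqVneq v x; first by subst x; rewrite uv e_irr /=; ring.
by move: excl; case: (e u x); case: (e v x) => //= _; ring.
Qed.

(** A member of an independent set is unblocked, so being unblocked splits into being alive and
    being selected. *)
Lemma palive_eq D u : indep_distr e D -> palive D u = punblocked D u - prob_mem D u.
Proof.
move=> [_ _ DI]; rewrite prob_memE; apply/eqP; rewrite eq_sym subr_eq -expectD.
apply/eqP; apply: eq_bigr => I _; have [->|/DI indI] := eqVneq (D I) 0.
  by rewrite !mul0r.
congr (_ * _); rewrite /alive; have [uI|uI] := boolP (u \in I); rewrite ?addr0 //=.
by rewrite add0r; have -> : unblocked u I by apply/forall_inP => v vI; exact: indI.
Qed.

Lemma palive2C D u v : palive2 D u v = palive2 D v u.
Proof. by apply: eq_expect => I; rewrite mulrC. Qed.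
End GreedyStep.

(** * Effect of one step on the ratios and on the objective *)

(** Expansion in [d] of a ratio whose numerator loses [d * E] while its denominators shrink. It
    rests on [1 <= (1 + p + q + 16 r^2)(1 - p)(1 - q)] for [0 <= p, q <= r <= 1/2]. *)
Lemma quotient_second_order (R : realFieldType) (c C E y z Y d : R) :
    0 <= c -> c <= C -> 0 <= E -> 0 <= y <= Y -> 0 <= z <= Y -> 0 <= d -> 2 * (d * Y) <= 1 ->
  (c - d * E) / ((1 - d * y) * (1 - d * z)) <=
  c + d * (c * (y + z) - E) + d ^+ 2 * (16 * C * Y ^+ 2).
Proof.
move=> c0 cC E0 /andP[y0 yY] /andP[z0 zY] d0 dY.
pose r := d * Y; pose p := d * y; pose q := d * z.
have p0 : 0 <= p by rewrite mulr_ge0.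
have q0 : 0 <= q by rewrite mulr_ge0.
have pr : p <= r by rewrite ler_wpM2l.
have qr : q <= r by rewrite ler_wpM2l.
have r2 : 2 * r <= 1 by [].
have mpos : 0 < (1 - p) * (1 - q) by rewrite mulr_gt0; lra.
rewrite -/p -/q ler_pdivrMr //.
have -> : c + d * (c * (y + z) - E) + d ^+ 2 * (16 * C * Y ^+ 2) =
  c * (1 + p + q) + C * (16 * r ^+ 2) - d * E by rewrite /p /q /r; ring.
have dE0 : 0 <= d * E by rewrite mulr_ge0.
have m1 : (1 - p) * (1 - q) <= 1 by nra.
have h1 : d * E * ((1 - p) * (1 - q)) <= d * E by rewrite ler_piMr.
have rr0 : 0 <= 16 * r ^+ 2 by rewrite mulr_ge0 ?sqr_ge0.
have h2 : c * (16 * r ^+ 2) <= C * (16 * r ^+ 2) by rewrite ler_wpM2r.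
have m4 : 1 <= 4 * ((1 - p) * (1 - q)).
  have : (1 / 2) * (1 / 2) <= (1 - p) * (1 - q) by rewrite ler_pM; lra.
  lra.
(* Here [(1 + p + q)(1 - p)(1 - q) = 1 - (p + q)^2 + p q (1 + p + q)], and by [m4] the term [16 r^2]
   still contributes [4 r^2 >= (p + q)^2]. *)
have h3 : 1 <= (1 + p + q + 16 * r ^+ 2) * ((1 - p) * (1 - q)).
  have : 4 * r ^+ 2 <= 16 * r ^+ 2 * ((1 - p) * (1 - q)).
    by have := ler_wpM2l (mulr_ge0 (ler0n _ 4) (sqr_ge0 r)) m4; lra.
  have : (p + q) ^+ 2 <= (2 * r) ^+ 2 by rewrite ler_sqr ?nnegrE; lra.
  have : 0 <= p * q * (1 + p + q) by rewrite !mulr_ge0 //; lra.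
  lra.
have := ler_wpM2l c0 h3.
have := ler_wpM2r (ltW mpos) h2.
by lra.
Qed.

Section StepBound.
Variables (R : realFieldType) (T : finType) (e : rel T).
Hypotheses (e_sym : symmetric e) (e_irr : irreflexive e) (e_tri : triangle_free e).

(** This is [c_uv]; the factor [e u v] makes it vanish on non-adjacent pairs. *)
Definition alive_ratio (D : {ffun {set T} -> R}) u v : R :=
  (e u v)%:R * palive2 e D u v / (punblocked e D u * punblocked e D v).

Lemma alive_ratioC D u v : alive_ratio D u v = alive_ratio D v u.
Proof. by rewrite /alive_ratio palive2C e_sym [X in _ / X]mulrC. Qed.

Variables (D : {ffun {set T} -> R}) (B : {set T}) (l s : T -> R) (J A d : R).
Hypothesis DP : indep_distr e D.
Local Notation a := (punblocked e D).
Hypotheses (A_ge1 : 1 <= A) (a_lb : forall u, u \in B -> 1 <= A * a u).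
Hypotheses (J_ge1 : 1 <= J) (l_le : forall u, u \in B -> l u <= J).
Hypothesis objJ : forall x, objective B l (alive_ratio D) x <= J.
Hypothesis s_eq : forall u, u \in B -> l u * s u = 1 + \sum_(v in B) alive_ratio D u v * s v.
Hypotheses (s_ge0 : forall u, u \in B -> 0 <= s u) (s_le : \sum_(u in B) s u <= J).
Hypothesis d_ge0 : 0 <= d.

(** Dividing by [a u] makes the probability of selecting [u] grow at about [s u]; vertices outside
    [B] are frozen. *)
Definition unit_rate u : R := if u \in B then s u / a u else 0.

Definition step_rate u : R := d * unit_rate u.

Local Notation y u := (\sum_(v in B) alive_ratio D u v * s v).
Local Notation S := (neighbor_alive e unit_rate).

Definition pair_loss u v : R :=
  expect D (fun I => (alive e u I)%:R * (alive e v I)%:R * (S u I + S v I)).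

Definition half_loss u v : R :=
  expect D (fun I => (alive e u I)%:R * (alive e v I)%:R * S u I).

Let A_ge0 : 0 <= A. Proof. exact: le_trans ler01 A_ge1. Qed.
Let J_ge0 : 0 <= J. Proof. exact: le_trans ler01 J_ge1. Qed.
Let D_ge0 : forall I, 0 <= D I. Proof. by case: DP. Qed.

Lemma punblocked_gt0 u : u \in B -> 0 < a u.
Proof.
move=> uB; have := a_lb uB => h; rewrite ltNge; apply/negP => a0.
have : A * a u <= 0 by rewrite mulr_ge0_le0 // A_ge0.
by lra.
Qed.

Lemma expect_le1 F : (forall I, F I <= 1) -> expect D F <= 1.
Proof.
move=> F1; have [_ D1 _] := DP; rewrite -[leRHS]D1; apply: ler_sum => I _.
by rewrite ler_piMr.
Qed.

Lemma palive2_ge0 u v : 0 <= palive2 e D u v.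
Proof. by apply: expect_ge0 => // I; rewrite mulr_ge0. Qed.

Lemma palive2_le1 u v : palive2 e D u v <= 1.
Proof.
by apply: expect_le1 => I; case: (alive e u I); case: (alive e v I); rewrite /=; lra.
Qed.

Lemma alive_ratio_ge0 u v : 0 <= alive_ratio D u v.
Proof.
by rewrite divr_ge0 ?mulr_ge0 ?palive2_ge0 // expect_ge0.
Qed.

Lemma inv_punblocked_le u : u \in B -> (a u)^-1 <= A.
Proof. by move=> uB; rewrite -[_^-1]mul1r ler_pdivrMr ?punblocked_gt0 // a_lb. Qed.

Lemma alive_ratio_le u v : u \in B -> v \in B -> alive_ratio D u v <= A ^+ 2.
Proof.
move=> uB vB; rewrite /alive_ratio invfM expr2.
rewrite -[leRHS]mul1r ler_pM ?mulr_ge0 ?palive2_ge0 ?invr_ge0 ?(ltW (punblocked_gt0 _)) //.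
  by case: (e u v); rewrite ?mul0r ?mul1r ?palive2_le1.
by rewrite ler_pM ?invr_ge0 ?(ltW (punblocked_gt0 _)) ?inv_punblocked_le.
Qed.

Lemma unit_rate_ge0 u : 0 <= unit_rate u.
Proof.
by rewrite /unit_rate; case: ifP => // uB; rewrite divr_ge0 ?s_ge0 ?ltW ?punblocked_gt0.
Qed.

Lemma sum_unit_rate_le : \sum_u unit_rate u <= A * J.
Proof.
have A0 := A_ge0.
apply: le_trans (ler_wpM2l A0 s_le).
rewrite -big_mkcond /= mulr_sumr; apply: ler_sum => u uB.
by rewrite mulrC ler_wpM2r ?s_ge0 ?inv_punblocked_le.
Qed.

Lemma neighbor_alive_ge0 u I : 0 <= S u I.
Proof. by apply: sumr_ge0 => x _; rewrite mulr_ge0 ?unit_rate_ge0. Qed.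

Lemma neighbor_alive_le u I : S u I <= A * J.
Proof.
apply: le_trans sum_unit_rate_le; rewrite /neighbor_alive big_mkcond.
apply: ler_sum => x _; case: ifP => _; rewrite ?unit_rate_ge0 //.
by case: (alive e x I); rewrite ?mulr1 ?mulr0 ?unit_rate_ge0.
Qed.

Lemma step_rate_ge0 u : 0 <= step_rate u.
Proof. by rewrite mulr_ge0 ?unit_rate_ge0. Qed.

Lemma sum_step_rate_le : A * J * d <= 1 -> \sum_u step_rate u <= 1.
Proof.
move=> h; apply: le_trans h; rewrite -mulr_sumr mulrC.
by rewrite ler_wpM2r // sum_unit_rate_le.
Qed.

Lemma critical_point_le u : u \in B -> s u <= J.
Proof.
move=> uB; apply: le_trans s_le; rewrite (bigD1 u) //= lerDl.
by apply: sumr_ge0 => v /andP[vB _]; exact: s_ge0.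
Qed.

Lemma ratio_sum_ge0 u : 0 <= y u.
Proof. by apply: sumr_ge0 => v vB; rewrite mulr_ge0 ?alive_ratio_ge0 ?s_ge0. Qed.

(** The critical-point equation reads [y u = l u * s u - 1], so the bound is free of [A]. *)
Lemma ratio_sum_le u : u \in B -> y u <= J ^+ 2.
Proof.
move=> uB; have := s_eq uB.
have : l u * s u <= J * J.
  apply: le_trans (_ : J * s u <= _); first by rewrite ler_wpM2r ?s_ge0 ?l_le.
  by rewrite ler_wpM2l ?critical_point_le.
by rewrite expr2; lra.
Qed.

(** The factor [1 / a x] in the rate of [x] completes the pair probability to [a u] times the
    ratio. *)
Lemma expect_neighbor_alive u : u \in B ->
  expect D (fun I => (alive e u I)%:R * S u I) = a u * y u.
Proof.
move=> uB; rewrite /neighbor_alive.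
transitivity (\sum_(x | e u x) unit_rate x * palive2 e D u x).
  under eq_expect do rewrite mulr_sumr.
  rewrite expect_sum; apply: eq_bigr => x _; rewrite -expectZ; apply: eq_expect => I; ring.
rewrite mulr_sumr big_mkcond [RHS]big_mkcond; apply: eq_bigr => x _ /=.
rewrite /unit_rate /alive_ratio; case: (boolP (x \in B)) => xB; last first.
  by rewrite mul0r; case: ifP.
have := punblocked_gt0 uB; have := punblocked_gt0 xB => ax au.
case: (e u x) => /=; last by rewrite !mul0r mulr0.
by field; rewrite !gt_eqF.
Qed.

Lemma punblocked_step u : u \in B ->
  punblocked e (greedy_step e D step_rate) u = a u * (1 - d * y u).
Proof.
move=> uB; rewrite punblocked_greedy_step //.
suff -> : \sum_(x | e u x) step_rate x * palive2 e D u x = d * (a u * y u) by ring.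
rewrite -expect_neighbor_alive // -expectZ /neighbor_alive.
under [RHS]eq_expect do rewrite !mulr_sumr.
rewrite expect_sum; apply: eq_bigr => x _; rewrite -expectZ; apply: eq_expect => I.
by rewrite /step_rate; ring.
Qed.

Lemma palive2_step u v : e u v ->
  palive2 e (greedy_step e D step_rate) u v = palive2 e D u v - d * pair_loss u v.
Proof.
move=> uv; rewrite palive2_greedy_step // /pair_loss -expectZ; congr (_ - _).
have step w I : neighbor_alive e step_rate w I = d * S w I.
  by rewrite /neighbor_alive mulr_sumr; apply: eq_bigr => x _; rewrite /step_rate; ring.
by apply: eq_expect => I; rewrite !step; ring.
Qed.

(** For [u], [v] in [B], the derivative at [d = 0] of the ratio after a step: shrinking denominators
    raise it, lost pairs lower it. *)
Definition first_order u v : R :=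
  alive_ratio D u v * (y u + y v) - (e u v)%:R * pair_loss u v / (a u * a v).

Lemma first_orderC u v : first_order u v = first_order v u.
Proof.
rewrite /first_order alive_ratioC e_sym [a u * _]mulrC [y u + _]addrC.
congr (_ - _ * _ / _); apply: eq_expect => I; ring.
Qed.

(** After splitting by symmetry, row [u] is [s u * (y u ^+ 2 - E[alive_u * S_u ^+ 2] / a u)]. As
    [E[alive_u * S_u] = a u * y u] and [P(u alive) <= a u], Cauchy-Schwarz makes every row
    nonpositive. *)
Lemma bilin_first_order_le0 : bilin B first_order s s <= 0.
Proof.
pose W1 u v := alive_ratio D u v * y u - (e u v)%:R * half_loss u v / (a u * a v).
have WE u v : first_order u v = W1 u v + W1 v u.
  rewrite /first_order /W1 -(alive_ratioC D u v) (e_sym v u) (mulrC (a v)).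
  have -> : pair_loss u v = half_loss u v + half_loss v u.
    by rewrite -expectD; apply: eq_expect => I; ring.
  by ring.
have -> : bilin B first_order s s = bilin B W1 s s + bilin B W1 s s.
  rewrite {2}/bilin exchange_big /bilin -big_split; apply: eq_bigr => u _ /=.
  by rewrite -big_split; apply: eq_bigr => v _ /=; rewrite WE; ring.
suff : bilin B W1 s s <= 0 by lra.
apply: sumr_le0 => u uB.
have au := punblocked_gt0 uB.
have -> : \sum_(v in B) W1 u v * s u * s v =
    s u * (y u ^+ 2 - expect D (fun I => (alive e u I)%:R * S u I ^+ 2) / a u).
  have -> : expect D (fun I => (alive e u I)%:R * S u I ^+ 2) =
      \sum_(v in B) (e u v)%:R * (s v / a v) * half_loss u v.
    under [RHS]eq_bigr do rewrite -expectZ.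
    rewrite -expect_sum; apply: eq_expect => I.
    rewrite expr2 mulrA [in LHS]mulrC {1}/neighbor_alive mulr_suml.
    rewrite big_mkcond [RHS]big_mkcond; apply: eq_bigr => v _ /=.
    rewrite /unit_rate; case: (v \in B); last by rewrite !mul0r; case: ifP.
    by case: (e u v); rewrite /=; ring.
  rewrite expr2 mulr_suml (mulr_suml _ _ (fun v => (e u v)%:R * _ * _)) -sumrB mulr_sumr.
  apply: eq_bigr => v vB; rewrite /W1.
  have av := punblocked_gt0 vB.
  by field; rewrite !gt_eqF.
rewrite mulr_ge0_le0 ?s_ge0 // subr_le0 ler_pdivlMr //.
(* Cauchy-Schwarz in the form of a nonnegative square centred at [y u]. *)
have : 0 <= expect D (fun I => (alive e u I)%:R * (S u I - y u) ^+ 2).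
  by apply: expect_ge0 => // I; rewrite mulr_ge0 ?sqr_ge0.
have -> : expect D (fun I => (alive e u I)%:R * (S u I - y u) ^+ 2) =
  expect D (fun I => (alive e u I)%:R * S u I ^+ 2)
    + (- 2 * y u) * (a u * y u) + y u ^+ 2 * palive e D u.
  rewrite -expect_neighbor_alive // -!expectZ -!expectD; apply: eq_expect => I; ring.
have : y u ^+ 2 * palive e D u <= y u ^+ 2 * a u.
  rewrite ler_wpM2l ?sqr_ge0 //; apply: le_expect => // I.
  by rewrite ler_nat /alive; case: (u \in I).
by lra.
Qed.

Lemma pair_loss_ge0 u v : 0 <= pair_loss u v.
Proof. by apply: expect_ge0 => // I; rewrite !mulr_ge0 // addr_ge0 ?neighbor_alive_ge0. Qed.

Lemma pair_loss_le u v : pair_loss u v <= 2 * A * J.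
Proof.
have AJ : 0 <= A * J by rewrite mulr_ge0.
have [_ D1 _] := DP.
have -> : 2 * A * J = \sum_I D I * (2 * A * J) by rewrite -mulr_suml D1 mul1r.
apply: ler_sum => I _; rewrite ler_wpM2l //.
have := neighbor_alive_le u I; have := neighbor_alive_le v I.
move=> h1 h2; have := neighbor_alive_ge0 u I; have := neighbor_alive_ge0 v I => h3 h4.
case: (alive e u I); case: (alive e v I); rewrite ?mulr1n ?mulr0n ?mul0r ?mulr0 ?mul0r ?mul1r.
all: lra.
Qed.

Lemma first_order_le u v : u \in B -> v \in B ->
  `|first_order u v| <= 2 * A ^+ 2 * J ^+ 2 + 2 * A ^+ 3 * J.
Proof.
move=> uB vB; have A0 := A_ge0.
have J0 := J_ge0.
have h1 : 0 <= alive_ratio D u v * (y u + y v).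
  by rewrite mulr_ge0 ?alive_ratio_ge0 ?addr_ge0 ?ratio_sum_ge0.
have h2 : alive_ratio D u v * (y u + y v) <= A ^+ 2 * (J ^+ 2 + J ^+ 2).
  by rewrite ler_pM ?alive_ratio_ge0 ?addr_ge0 ?ratio_sum_ge0 ?alive_ratio_le ?lerD ?ratio_sum_le.
have ia w : w \in B -> 0 <= (a w)^-1 by move=> wB; rewrite invr_ge0 ltW ?punblocked_gt0.
have h3 : 0 <= (e u v)%:R * pair_loss u v / (a u * a v).
  by rewrite invfM !mulr_ge0 ?pair_loss_ge0 ?ia.
have h4 : (e u v)%:R * pair_loss u v / (a u * a v) <= 2 * A * J * (A * A).
  rewrite invfM ler_pM ?mulr_ge0 ?pair_loss_ge0 ?ia //.
    case: (e u v); rewrite ?mul1r ?pair_loss_le // mul0r !mulr_ge0 //.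
  by rewrite ler_pM ?ia ?inv_punblocked_le.
have : 0 <= A ^+ 3 * J by rewrite mulr_ge0 ?exprn_ge0.
have : 0 <= A ^+ 2 * J ^+ 2 by rewrite mulr_ge0 ?exprn_ge0.
by rewrite /first_order ler_norml; lra.
Qed.

Lemma alive_ratio_step u v : u \in B -> v \in B -> 2 * (d * J ^+ 2) <= 1 ->
  alive_ratio (greedy_step e D step_rate) u v <=
  alive_ratio D u v + d * first_order u v + d ^+ 2 * (16 * A ^+ 2 * (J ^+ 2) ^+ 2).
Proof.
move=> uB vB dJ; have au := punblocked_gt0 uB; have av := punblocked_gt0 vB.
have A0 := A_ge0.
have J0 := J_ge0.
rewrite {1}/alive_ratio; case: (boolP (e u v)) => uv; last first.
  rewrite !mul0r /first_order /alive_ratio (negPf uv) !mul0r subrr mulr0 !add0r.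
  by rewrite !mulr_ge0 ?exprn_ge0.
rewrite mul1r palive2_step // !punblocked_step // /first_order uv mul1r.
have -> : (palive2 e D u v - d * pair_loss u v) / (a u * (1 - d * y u) * (a v * (1 - d * y v))) =
  (alive_ratio D u v - d * (pair_loss u v / (a u * a v))) / ((1 - d * y u) * (1 - d * y v)).
  have yd w : w \in B -> 1 - d * y w != 0.
    move=> wB; have := ler_wpM2l d_ge0 (ratio_sum_le wB) => h.
    by rewrite gt_eqF //; move: h dJ; lra.
  have -> : alive_ratio D u v = palive2 e D u v / (a u * a v).
    by rewrite /alive_ratio uv mul1r.
  by field; rewrite !yd // !gt_eqF.
apply: quotient_second_order => //.
- exact: alive_ratio_ge0.
- exact: alive_ratio_le.
- by rewrite divr_ge0 ?pair_loss_ge0 ?mulr_ge0 ?ltW.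
- by rewrite ratio_sum_ge0 ratio_sum_le.
- by rewrite ratio_sum_ge0 ratio_sum_le.
Qed.

(** This is [objective_perturbation] with [first_order] as [W]; [w] and [K] are the bounds of
    [first_order_le] and [alive_ratio_step]. *)
Lemma objective_step (B' : {set T}) (k : R) : B' \subset B -> d <= 1 ->
    A * J * d <= 1 -> 2 * J ^+ 2 * d <= 1 ->
    (let w := 2 * A ^+ 2 * J ^+ 2 + 2 * A ^+ 3 * J in
     let K := 16 * A ^+ 2 * (J ^+ 2) ^+ 2 in
     [/\ 4 * J * w * d <= 1, 8 * J * K * d <= 1 &
         d * (2 * J ^+ 3 * w ^+ 2 + 2 * K * J ^+ 2) <= k]) ->
  forall x, objective B' l (alive_ratio (greedy_step e D step_rate)) x
    <= \sum_(u in B) s u + d * k.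
Proof.
move=> B'B d1 dAJ dJ2 [dw dK dk].
have [D'0 _ _] := greedy_step_distr e_sym e_irr DP step_rate_ge0 (sum_step_rate_le dAJ).
have A0 := A_ge0.
have J0 := J_ge0.
apply: (objective_perturbation B'B J_ge1 _ _ _ _ objJ s_eq s_ge0 s_le _ _
  bilin_first_order_le0 d_ge0 d1 _ _ dw dK dk).
- exact: alive_ratioC.
- by move=> u v _ _; exact: alive_ratio_ge0.
- move=> u v _ _; rewrite divr_ge0 //; last by rewrite mulr_ge0 // expect_ge0.
  by rewrite mulr_ge0 // expect_ge0 // => I; rewrite mulr_ge0.
- exact: first_orderC.
- by move=> u v uB vB; apply: alive_ratio_step => //; rewrite mulrCA mulrC.
- by move=> u v uB vB; exact: first_order_le.
- by rewrite addr_ge0 ?mulr_ge0 ?exprn_ge0.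
- by rewrite !mulr_ge0 ?exprn_ge0.
Qed.
End StepBound.

(** * Iterating steps until every target is reached *)

(** The smallness conditions on the step size are put in the form [m * d <= 1], so that one [d]
    meets them all. *)
Lemma exists_small_scale (R : realFieldType) (ms : seq R) :
  exists2 d : R, 0 < d & forall m, m \in ms -> m * d <= 1.
Proof.
have s0 : 0 <= \sum_(m <- ms) `|m| by apply: sumr_ge0.
exists (1 + \sum_(m <- ms) `|m|)^-1; first by rewrite invr_gt0; lra.
move=> m mms; rewrite ler_pdivrMr ?mul1r; last by lra.
have : `|m| <= \sum_(m <- ms) `|m|.
  rewrite (big_rem m) //= lerDl; exact: sumr_ge0.
have := ler_norm m; lra.
Qed.

Section Iteration.
Variables (R : realType) (T : finType) (e : rel T) (t beta : T -> R).
Hypotheses (e_sym : symmetric e) (e_irr : irreflexive e) (e_tri : triangle_free e).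
Hypotheses (t_ge0 : forall u, 0 <= t u) (beta_gt0 : forall u, 0 < beta u).
Implicit Type D : {ffun {set T} -> R}.

Let lam u : R := (degree e u).+1%:R.

Definition active D : {set T} := [set u | prob_mem D u < t u]%SET.

(** The objective may grow a little in each step; charging this growth to [\sum_u prob_mem D u],
    itself at most [#|T|], bounds it during the whole process. *)
Definition invariant D : Prop :=
  [/\ indep_distr e D,
      forall u, u \in active D -> expR (- (beta u * prob_mem D u)) <= punblocked e D u
    & forall x, objective (active D) lam (alive_ratio e D) x
        <= #|T|.+1%:R + \sum_u prob_mem D u].

Lemma prob_mem_ge0 D u : indep_distr e D -> 0 <= prob_mem D u.
Proof. by move=> [D0 _ _]; apply: sumr_ge0. Qed.

Lemma sum_prob_mem_le D : indep_distr e D -> \sum_u prob_mem D u <= #|T|%:R.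
Proof.
move=> [D0 D1 _]; rewrite -sum1_card natr_sum; apply: ler_sum => u _.
rewrite mulr1n -D1 [leRHS](bigID (fun I : {set T} => u \in I)) /= lerDl.
exact: sumr_ge0.
Qed.

Lemma invariant_init : exists D, invariant D.
Proof.
pose D : {ffun {set T} -> R} := [ffun I => (I == finset.set0)%:R].
have DE (F : {set T} -> R) : expect D F = F finset.set0.
  rewrite /expect (bigD1 finset.set0) //= ffunE eqxx mul1r big1 ?addr0 // => I /negPf I0.
  by rewrite ffunE I0 mul0r.
have ub u : unblocked e u finset.set0 by apply/forall_inP => v; rewrite finset.in_set0.
have al u : alive e u finset.set0 by rewrite /alive finset.in_set0 ub.
have p0 u : prob_mem D u = 0 by rewrite prob_memE DE finset.in_set0.
have a1 u : punblocked e D u = 1 by rewrite /punblocked DE ub.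
have e1 u v : palive2 e D u v = 1 by rewrite /palive2 DE !al mulr1.
exists D; split.
- split=> [I||I]; first by rewrite ffunE.
    rewrite -[RHS](DE (fun=> 1)); apply: eq_bigr => I _; by rewrite mulr1.
  rewrite ffunE; have [->|_] := eqVneq I finset.set0; rewrite ?eqxx // => _ x y.
  by rewrite finset.in_set0.
- by move=> u _; rewrite p0 a1 mulr0 oppr0 expR0.
move=> x; rewrite big1 ?addr0 //; set B := active D.
rewrite /objective /qform.
(* At the empty set the ratios form the adjacency matrix, and [2 * x u * x v <= x u ^+ 2 + x v ^+ 2]
   on each edge gives the degrees. The [+ 1] in [lam] leaves [x u ^+ 2 >= 2 * x u - 1]. *)
have : bilin B (alive_ratio e D) x x <= \sum_(u in B) (degree e u)%:R * x u ^+ 2.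
  pose h u v : R := (e u v)%:R * x u ^+ 2 / 2.
  have le1 : bilin B (alive_ratio e D) x x <= \sum_(u in B) \sum_(v in B) (h u v + h v u).
    apply: ler_sum => u _; apply: ler_sum => v _.
    rewrite /alive_ratio /h !a1 e1 (e_sym v u); case: (e u v); last by rewrite !mul0r; lra.
    rewrite !mulr1 divr1 !mul1r; have := sqr_ge0 (x u - x v); lra.
  apply: le_trans le1 _.
  have -> : \sum_(u in B) \sum_(v in B) (h u v + h v u) =
      2 * \sum_(u in B) \sum_(v in B) h u v.
    under eq_bigr do rewrite big_split /=.
    by rewrite big_split /= [X in _ + X]exchange_big /=; ring.
  rewrite mulr_sumr; apply: ler_sum => u uB.
  have -> : (degree e u)%:R * x u ^+ 2 = 2 * \sum_v h u v.
    rewrite /h -!mulr_suml -natr_sum; have -> : (\sum_v e u v)%N = degree e u.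
      rewrite /degree -sum1_card [RHS]big_mkcond; apply: eq_bigr => v _.
      by rewrite inE; case: (e u v).
    by field.
  rewrite ler_wpM2l // big_mkcond; apply: ler_sum => v _; case: ifP => // _.
  by rewrite /h divr_ge0 // mulr_ge0 ?sqr_ge0.
have : 2 * \sum_(u in B) x u <= \sum_(u in B) x u ^+ 2 + #|T|%:R.
  apply: le_trans (_ : \sum_(u in B) (x u ^+ 2 + 1) <= _).
    rewrite mulr_sumr; apply: ler_sum => u _; have := sqr_ge0 (x u - 1); lra.
  by rewrite big_split /= lerD2l sumr_const ler_nat max_card.
have -> : \sum_(u in B) lam u * x u ^+ 2 =
  \sum_(u in B) (degree e u)%:R * x u ^+ 2 + \sum_(u in B) x u ^+ 2.
  by rewrite -big_split; apply: eq_bigr => u _; rewrite /lam -addn1 natrD /=; ring.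
by rewrite -natr1; lra.
Qed.

Hypothesis beta_large :
  forall u, 0 < t u -> (degree e u).+1%:R <= beta u * (1 - t u * expR (beta u * t u)).

(** Take one greedy step at the critical rates. The constants [A], [J], [b], [d] are fixed before
    [D], so the gain [d / b] is uniform. *)
Lemma invariant_improve : exists2 k : R, 0 < k &
  forall D, invariant D -> active D != finset.set0 ->
  exists2 D', invariant D' & \sum_u prob_mem D u + k <= \sum_u prob_mem D' u.
Proof.
(* Active vertices have [prob_mem D u < t u], so the invariant bounds [1 / a_u] by this [A]. *)
pose A : R := expR (\sum_u beta u * t u).
have bt0 u : 0 <= beta u * t u by rewrite mulr_ge0 // ltW.
have A_ge1 : 1 <= A by rewrite -expR0 ler_expR sumr_ge0.
pose J : R := #|T|.+1%:R + #|T|%:R.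
have J_ge1 : 1 <= J by rewrite /J -natrD ler1n addSn.
pose w := 2 * A ^+ 2 * J ^+ 2 + 2 * A ^+ 3 * J.
pose K := 16 * A ^+ 2 * (J ^+ 2) ^+ 2.
pose b := 1 + \sum_u beta u.
have b_ge u : beta u <= b.
  rewrite /b (bigD1 u) //=; have : 0 <= \sum_(v | v != u) beta v.
    by apply: sumr_ge0 => v _; exact: ltW.
  lra.
have b_gt0 : 0 < b by rewrite /b ltr_pwDl // sumr_ge0 // => u _; exact: ltW.
have [d d_gt0 d_small] := exists_small_scale
  [:: 1; A * J; 2 * J ^+ 2; 4 * J * w; 8 * J * K;
      (2 * J ^+ 3 * w ^+ 2 + 2 * K * J ^+ 2) * b; J ^+ 2 * (J ^+ 2 + 1)].
exists (d / b); first by rewrite divr_gt0.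
move=> D [DP a_ge objJ] /finset.set0Pn[u0 u0B]; set B := active D in a_ge objJ u0B *.
have d_ge0 := ltW d_gt0.
have p0 u := prob_mem_ge0 u DP.
have pt u : u \in B -> prob_mem D u < t u by rewrite inE.
have a_lb u : u \in B -> 1 <= A * punblocked e D u.
  move=> uB; have A0 : 0 <= A by exact: expR_ge0.
  apply: le_trans (ler_wpM2l A0 (a_ge u uB)); rewrite /A -expRD -expR0 ler_expR subr_ge0.
  rewrite (bigD1 u) //=; apply: le_trans (_ : beta u * t u <= _).
    by rewrite ler_wpM2l // ltW ?pt.
  by rewrite lerDl sumr_ge0.
have a_gt0 u : u \in B -> 0 < punblocked e D u.
  by move=> uB; apply: lt_le_trans (a_ge u uB); exact: expR_gt0.
have pJ : #|T|.+1%:R + \sum_u prob_mem D u <= J by rewrite lerD2l sum_prob_mem_le.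
have l_le u : u \in B -> lam u <= J.
  move=> _; apply: le_trans (_ : #|T|.+1%:R <= _); first by rewrite ler_nat ltnS max_card.
  by rewrite /J lerDl.
have D0 : forall I, 0 <= D I by case: DP.
have [] := @objective_critical_point R T B lam (alive_ratio e D) _ _ _ _ objJ.
- by apply: ltr_pwDl => //; apply: sumr_ge0.
- by move=> u v; exact: alive_ratioC.
- by move=> u v _ _; exact: alive_ratio_ge0.
move=> s [s_eq s_ge0 s_le].
have s_leJ := le_trans s_le pJ.
have objJ' x := le_trans (objJ x) pJ.
set D' := greedy_step e D (step_rate e D B s d).
have dAJ : A * J * d <= 1 by apply: d_small; rewrite !inE eqxx !orbT.
have rate0 := step_rate_ge0 A_ge1 a_lb s_ge0 d_ge0.
have D'P : indep_distr e D'.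
  by apply: greedy_step_distr => //; exact: (sum_step_rate_le A_ge1 a_lb s_ge0 s_leJ d_ge0 dAJ).
(* By [palive_eq] this is [P(u alive) / a_u], the conditional probability that an unblocked [u] is
   alive. *)
pose theta u := 1 - prob_mem D u / punblocked e D u.
have p'E u : u \in B -> prob_mem D' u = prob_mem D u + d * (s u * theta u).
  move=> uB; rewrite prob_mem_greedy_step palive_eq // /step_rate /unit_rate uB /theta.
  by congr (_ + _); field; rewrite gt_eqF ?a_gt0.
have p'ge u : prob_mem D u <= prob_mem D' u.
  rewrite prob_mem_greedy_step lerDl mulr_ge0 ?rate0 // expect_ge0 //.
(* While [u] is active, [prob_mem D u < t u] and [1 / a_u <= expR (beta u * t u)], so [beta_large]
   applies. *)
have theta_ge u : u \in B -> lam u <= beta u * theta u.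
  move=> uB; apply: le_trans (beta_large (le_lt_trans (p0 u) (pt u uB))) _.
  rewrite ler_wpM2l ?(ltW (beta_gt0 u)) // lerD2l lerN2.
  rewrite ler_pM ?invr_ge0 ?(ltW (a_gt0 _ _)) ?(ltW (pt _ _)) //.
  rewrite -[leRHS]invrK lef_pV2 ?posrE ?invr_gt0 ?expR_gt0 ?a_gt0 // -expRN.
  apply: le_trans (a_ge u uB); rewrite ler_expR lerN2 ler_wpM2l ?(ltW (beta_gt0 u)) //.
  by rewrite ltW ?pt.
have ls_ge1 u : u \in B -> 1 <= lam u * s u.
  move=> uB; rewrite s_eq // lerDl; apply: sumr_ge0 => v vB.
  by rewrite mulr_ge0 ?s_ge0 ?alive_ratio_ge0.
have bst u : u \in B -> lam u * s u <= beta u * (s u * theta u).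
  by move=> uB; rewrite mulrCA [_ * s u]mulrC ler_wpM2l ?s_ge0 ?theta_ge.
(* A single active vertex gains enough: [beta u0 * (s u0 * theta u0) >= lam u0 * s u0 >= 1], and
   [beta u0 <= b]. *)
have sum_ge : \sum_u prob_mem D u + d / b <= \sum_u prob_mem D' u.
  rewrite (bigD1 u0) //= [leRHS](bigD1 u0) //= p'E //.
  have : \sum_(u | u != u0) prob_mem D u <= \sum_(u | u != u0) prob_mem D' u.
    by apply: ler_sum => u _.
  have : d / b <= d * (s u0 * theta u0).
    rewrite ler_wpM2l // -[b^-1]mul1r ler_pdivrMr //.
    have h := le_trans (ls_ge1 _ u0B) (bst _ u0B).
    apply: le_trans h _; rewrite mulrC ler_wpM2l ?b_ge //.
    rewrite -(pmulr_rge0 _ (beta_gt0 u0)); have := le_trans (ls_ge1 _ u0B) (bst _ u0B); lra.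
  lra.
have subB : active D' \subset B.
  by apply/fintype.subsetP => u; rewrite !inE; exact: le_lt_trans.
exists D' => //; split=> //.
- move=> u /(fintype.subsetP subB) uB; rewrite p'E //.
  rewrite (punblocked_step e_sym s d A_ge1 a_lb uB).
  set y := \sum_(v in B) _.
  have yE : lam u * s u = 1 + y by rewrite s_eq.
  have y0 : 0 <= y by have := ls_ge1 u uB; rewrite yE; lra.
  have yJ : y <= J ^+ 2 := ratio_sum_le J_ge1 l_le s_eq s_ge0 s_leJ uB.
  set z := s u * theta u; have zy : 1 + y <= beta u * z by rewrite -yE bst.
  rewrite mulrDr opprD expRD.
  apply: ler_pM (a_ge u uB) _; rewrite ?expR_ge0 //.
  (* Then [(1 - d y)(1 + d (1 + y)) = 1 + d (1 - d y (y + 1)) >= 1]: the right-hand side [1] of the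
     critical-point equation absorbs the second-order error. *)
  have dyy : d * (y * (y + 1)) <= 1.
    apply: le_trans (_ : J ^+ 2 * (J ^+ 2 + 1) * d <= _); last first.
      by apply: d_small; rewrite !inE eqxx !orbT.
    by rewrite mulrC ler_wpM2r // ler_pM //; lra.
  have dy1 : d * y <= 1.
    have : d * (y * (y + 1)) >= 0 by rewrite !mulr_ge0 //; lra.
    have : 2 * J ^+ 2 * d <= 1 by apply: d_small; rewrite !inE eqxx !orbT.
    by have := ler_wpM2r d_ge0 yJ; lra.
  have z0 : 0 <= d * (beta u * z) by rewrite mulr_ge0 //; lra.
  rewrite mulrCA expRN; apply: le_trans (_ : (1 + d * (beta u * z))^-1 <= _).
    rewrite lef_pV2 ?posrE ?expR_gt0 ?expR_ge1Dx //; lra.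
  rewrite -[_^-1]mul1r ler_pdivrMr; last by lra.
  have := ler_wpM2l (mulr_ge0 d_ge0 (_ : 0 <= 1 - d * y)) zy => /(_ ltac:(lra)).
  have := ler_wpM2l d_ge0 dyy.
  by lra.
(* With [k = 1 / b], the growth of the objective is paid for by the gain [d / b] in [sum_ge]. *)
move=> x; apply: le_trans (_ : \sum_(u in B) s u + d * b^-1 <= _); last first.
  by move: s_le sum_ge; lra.
apply: (objective_step e_sym e_irr e_tri DP A_ge1 a_lb J_ge1 l_le objJ' s_eq s_ge0 s_leJ) => //.
- by rewrite -[d]mul1r; apply: d_small; rewrite !inE eqxx.
- by apply: d_small; rewrite !inE eqxx !orbT.
- split; [by apply: d_small; rewrite !inE eqxx !orbT ..|].
  rewrite -[b^-1]mul1r ler_pdivlMr // -[leLHS]mulrA [leLHS]mulrC; apply: d_small.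
  by rewrite !inE eqxx !orbT.
Qed.

(* Each improvement step raises [\sum_u prob_mem D u <= #|T|] by the same amount. *)
Theorem indep_distr_prob_mem_ge :
  exists2 D, indep_distr e D & forall u, t u <= prob_mem D u.
Proof.
have [k k0 step] := invariant_improve.
(* [n] limits the improvements still possible; [n = 0] contradicts [sum_prob_mem_le]. *)
suff main n D : invariant D -> #|T|%:R < \sum_u prob_mem D u + k * n%:R ->
    exists2 D, invariant D & active D = finset.set0.
  have [D0 inv0] := invariant_init.
  have [|D invD actD] := main (Num.Def.truncn (#|T|%:R / k)).+1 D0 inv0.
    apply: ltr_wpDl; first by apply: sumr_ge0 => u _; case: inv0 => /prob_mem_ge0.
    by rewrite mulrC -ltr_pdivrMr // truncnS_gt.
  exists D => [|u]; first by case: invD.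
  rewrite leNgt; apply/negP => pt; have : u \in active D by rewrite inE.
  by rewrite actD finset.in_set0.
elim: n D => [|n IHn] D invD.
  by rewrite mulr0 addr0 ltNge sum_prob_mem_le //; case: invD.
move=> lt; have [act0|act] := eqVneq (active D) finset.set0; first by exists D.
have [D' invD' le] := step D invD act.
apply: (IHn D') => //; move: lt; rewrite -natr1; lra.
Qed.
End Iteration.

(** * The error function, targets and exponents *)

Section Error.
Variable R : realType.

(* With [r = sqrt (ln d)], the target is [(1 - 1/r) ln d / d] and the exponent is
   [d (1 + 1/(2r))]. *)
Lemma target_exponent_large (r d t b : R) : 300 <= r ->
    d = expR (r ^+ 2) -> t = (1 - r^-1) * (r ^+ 2 / d) -> b = d * (1 + r^-1 / 2) ->
  d + 1 <= b * (1 - t * expR (b * t)).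
Proof.
move=> r_ge dE tE bE; have r0 : 0 < r by lra.
have d0 : 0 < d by rewrite dE expR_gt0.
have i0 : 0 < r^-1 by rewrite invr_gt0.
have ir : r * r^-1 = 1 by rewrite divff ?gt_eqF.
have btE : b * t = r ^+ 2 - r / 2 - 1 / 2.
  by rewrite bE tE; field; rewrite !gt_eqF.
have exp_le : expR (b * t) <= d * expR (- (r / 2)).
  by rewrite dE -expRD ler_expR btE; lra.
have exp_ge : (r / 12) ^+ 6 <= expR (r / 2).
  have -> : r / 2 = 6%:R * (r / 12) by field.
  rewrite expRM_natl; apply: lerXn2r; rewrite ?nnegrE ?expR_ge0 //; first by lra.
  by apply: le_trans (expR_ge1Dx _); lra.
(* As [144 ^ 3 = 12 ^ 6], the bound is [r ^+ 2 / (r / 12) ^+ 6]. *)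
have tau_le : t * expR (b * t) <= (144 * r^-1) ^+ 3 * r^-1.
  have t_le : t <= r ^+ 2 / d.
    rewrite tE ler_piMl ?divr_ge0 ?sqr_ge0 ?(ltW d0) //; lra.
  apply: le_trans (_ : r ^+ 2 / d * (d * expR (- (r / 2))) <= _).
    rewrite ler_pM ?expR_ge0 // tE mulr_ge0 ?divr_ge0 ?sqr_ge0 ?(ltW d0) //.
    rewrite subr_ge0 invf_le1 //; lra.
  rewrite mulrA divfK ?gt_eqF // expRN.
  rewrite ler_pdivrMr ?expR_gt0 //.
  apply: le_trans (_ : (144 * r^-1) ^+ 3 * r^-1 * (r / 12) ^+ 6 <= _); last first.
    by rewrite ler_wpM2l // mulr_ge0 ?exprn_ge0 ?mulr_ge0 ?(ltW i0).
  have -> // : (144 * r^-1) ^+ 3 * r^-1 * (r / 12) ^+ 6 = r ^+ 2.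
  by field; rewrite gt_eqF.
(* The threshold [300] exceeds [288 = 2 * 144], so the cube in [tau8] is at most [1 / 8]. *)
have i_le : 288 * r^-1 <= 1.
  by rewrite -ir ler_wpM2r ?(ltW i0) //; lra.
have tau8 : (144 * r^-1) ^+ 3 * r^-1 <= r^-1 / 8.
  have : (144 * r^-1) ^+ 3 <= (1 / 2) ^+ 3.
    by apply: lerXn2r; rewrite ?nnegrE ?mulr_ge0 ?(ltW i0) //; lra.
  by move=> /(ler_wpM2r (ltW i0)); lra.
have d_ge : 4 * r <= d.
  rewrite dE; apply: le_trans (expR_ge1Dx _).
  by have := mulr_ge0 (ltW r0) (_ : 0 <= r - 4) => /(_ ltac:(lra)); lra.
(* Since [(1 + 1/(2r))(1 - 1/(8r)) >= 1 + 1/(4r)], this pays for the [+ 1] in the goal. *)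
have d_ge' : 1 <= d * (r^-1 / 4).
  have := ler_wpM2r (ltW i0) d_ge; rewrite -mulrA ir; lra.
set tau := t * _ in tau_le *.
have b0 : 0 <= b by rewrite bE mulr_ge0 ?(ltW d0) //; lra.
apply: le_trans (_ : b * (1 - r^-1 / 8) <= _); last by rewrite ler_wpM2l //; lra.
rewrite bE.
have : d * (r^-1 * (1 - r^-1)) >= 0.
  by rewrite !mulr_ge0 ?(ltW d0) ?(ltW i0) //; lra.
have : d * (r^-1 * r^-1) >= 0 by rewrite !mulr_ge0 ?(ltW d0) ?(ltW i0).
by lra.
Qed.

Let sqrtln (d : nat) : R := Num.sqrt (ln d%:R).

(** The value [1] below the threshold makes the target zero there, so only large degrees carry a
    requirement. *)
Definition degree_error (d : nat) : R :=
  if 300 <= sqrtln d then (sqrtln d)^-1 else 1.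

Lemma cvg_degree_error : (degree_error d @[d --> \oo] --> (0 : R))%classic.
Proof.
apply/cvgrPdist_lt => eps eps0; near=> d.
(* Once [d > expR (M ^+ 2)], [sqrtln d] exceeds both the threshold and [1 / eps]. *)
pose M : R := 300 + eps^-1.
have e0 : 0 < eps^-1 by rewrite invr_gt0.
have M0 : 0 < M by rewrite /M; lra.
have dM : expR (M ^+ 2) < d%:R by near: d; exact: nbhs_infty_gtr.
have d0 : (0 : R) < d%:R by exact: lt_trans (expR_gt0 _) dM.
have ML : M < sqrtln d.
  rewrite -(ger0_norm (ltW M0)) -sqrtr_sqr ltr_sqrt.
    by rewrite -ltr_expR lnK.
  by apply: ln_gt0; apply: le_lt_trans dM; rewrite -expR0 ler_expR sqr_ge0.
rewrite /degree_error ifT; last by move: ML; rewrite /M; lra.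
have s0 : 0 < sqrtln d by exact: lt_trans ML.
rewrite sub0r normrN ger0_norm ?invr_ge0 ?(ltW s0) //.
rewrite -[ltRHS]invrK ltf_pV2 ?posrE //.
by move: ML; rewrite /M; lra.
Unshelve. all: by end_near.
Qed.

Lemma local_shearer (T : finType) (e : rel T) :
    simple_graph e -> triangle_free e ->
  exists D : {ffun {set T} -> R}, indep_distr e D /\
    forall v, (1 - degree_error (degree e v)) * (ln (degree e v)%:R / (degree e v)%:R)
      <= prob_mem D v.
Proof.
move=> [e_sym e_irr] e_tri.
pose big v := 300 <= sqrtln (degree e v).
pose t v : R := (1 - degree_error (degree e v)) * (ln (degree e v)%:R / (degree e v)%:R).
(* Below the threshold the target is [0] and the vertex is never active; any positive exponent would
   do. *)
pose b v : R := if big v then (degree e v)%:R * (1 + (sqrtln (degree e v))^-1 / 2) else 1.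
have bigP v : big v ->
    (ln (degree e v)%:R = sqrtln (degree e v) ^+ 2 :> R) /\
    ((degree e v)%:R = expR (sqrtln (degree e v) ^+ 2) :> R).
  rewrite /big => bv.
  have lngt0 : 0 < ln (degree e v)%:R :> R.
    by rewrite -sqrtr_gt0; move: bv; rewrite /sqrtln; lra.
  (* [ln] is [0] at nonpositive arguments, so a positive value forces a positive degree. *)
  have d0 : 0 < (degree e v)%:R :> R.
    by rewrite ltNge; apply/negP => /ln0 eq0; rewrite eq0 ltxx in lngt0.
  by rewrite /sqrtln sqr_sqrtr ?(ltW lngt0) // lnK.
have tE v : t v = if big v then (1 - (sqrtln (degree e v))^-1) *
    (sqrtln (degree e v) ^+ 2 / expR (sqrtln (degree e v) ^+ 2)) else 0.
  rewrite /t /degree_error -/(big v); case: ifP => bv; last by rewrite subrr mul0r.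
  by have [-> ->] := bigP v bv.
have [||| D DP Dt] := @indep_distr_prob_mem_ge R T e t b e_sym e_irr e_tri.
- move=> v; rewrite tE; case: ifP => // bv; rewrite mulr_ge0 ?divr_ge0 ?sqr_ge0 ?expR_ge0 //.
  by rewrite subr_ge0 invf_le1; move: bv; rewrite /big; lra.
- move=> v; rewrite /b; case: ifP => // bv; rewrite (bigP v bv).2 mulr_gt0 ?expR_gt0 //.
  have : 0 <= (sqrtln (degree e v))^-1 by rewrite invr_ge0 sqrtr_ge0.
  by lra.
- move=> v; rewrite -natr1; case bv: (big v); last by rewrite tE bv ltxx.
  move=> _; apply: (target_exponent_large bv) => //; first exact: (bigP v bv).2.
    by rewrite tE bv (bigP v bv).2.
  by rewrite /b bv.
by exists D.
Qed.
End Error.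

Local Open Scope classical_set_scope.

Theorem theorem1p2 (R : realType) :
  exists eps : nat -> R,
    (eps d @[d --> \oo] --> (0 : R)) /\
    forall (T : finType) (e : rel T),
      simple_graph e -> triangle_free e ->
      exists D : {ffun {set T} -> R},
        indep_distr e D /\
        forall v : T, (1 <= degree e v)%N ->
          (1 - eps (degree e v)) * (ln (degree e v)%:R / (degree e v)%:R)
            <= prob_mem D v.
Proof.
exists (@degree_error R); split; first exact: cvg_degree_error.
move=> T e eP e_tri; have [D [DP Dv]] := local_shearer R eP e_tri.
by exists D; split=> // v _; exact: Dv.
Qed.
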